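(* Let $n\ge 2$ be an integer, let $\lambda^n$ be Lebesgue measure on $\mathbb{R}^n$, and let $g:\mathbb{R}\to\mathbb{R}^n$ be any surjective function. For $\theta\in\mathbb{R}$ let $P_\theta$ be the joint law on $\mathbb{R}^n$ (with its Borel $\sigma$-algebra) of $n$ independent $N(\theta,1)$ random variables, and define $f_\theta:\mathbb{R}^n\to\mathbb{R}$ by $$f_\theta(x_1,\dots,x_n):=\frac{1}{(2\pi)^{n/2}}\exp\Big\{-\frac12\Big(\sum_{i=1}^n x_i^2\Big)+\theta\Big(\sum_{i=1}^n x_i\Big)-\frac n2\theta^2\Big\}\,\mathbf{1}_{\mathbb{R}^n\setminus\{g(\theta)\}}(x_1,\dots,x_n).$$ Let $T:\mathbb{R}^n\to\mathbb{R}^n$ be the identity function. Then: (1) for every $\theta\in\mathbb{R}$, $f_\theta$ is a density of $P_\theta$ with respect to $\lambda^n$; (2) for all $x,y\in\mathbb{R}^n$, $T(x)=T(y)$ if and only if there exists a finite constant $h_{xy}>0$, independent of $\theta$, such that $f_\theta(y)=f_\theta(x)h_{xy}$ for every $\theta\in\mathbb{R}$; (3) $T$ is not minimal sufficient for the statistical model $\{P_\theta\}_{\theta\in\mathbb{R}}$.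
   Context: A statistical model is a triple $(\mathcal{X},\Sigma,\{P_\theta\}_{\theta\in\Theta})$ with $(\mathcal{X},\Sigma)$ a measurable space, $\Theta$ a non-empty set and each $P_\theta$ a probability measure on $(\mathcal{X},\Sigma)$. A statistic is a measurable function $T:\mathcal{X}\to\mathcal{T}$ into a measurable space $(\mathcal{T},\Sigma_{\mathcal{T}})$. $T$ is sufficient iff for each $E\in\Sigma$ there is a measurable $\kappa_E:\mathcal{T}\to\mathbb{R}$ such that for every $\theta\in\Theta$, $P_\theta(E\mid T)=\kappa_E(T)$ $P_\theta$-a.e. (where $P_\theta(E\mid T)$ is the conditional probability given $\sigma(T)$). $T$ is minimal sufficient iff it is sufficient and, for every measurable space $(\mathcal{S},\Sigma_{\mathcal{S}})$ and every sufficient statistic $S:\mathcal{X}\to\mathcal{S}$, there is a measurable $f:\mathcal{S}\to\mathcal{T}$ such that for each $\theta\in\Theta$, $T=f(S)$ $P_\theta$-a.e. A density of $P_\theta$ with respect to $\mu$ is a Radon--Nikodym derivative $dP_\theta/d\mu$. Here $\mathbb{R}^n$ carries its Borel $\sigma$-algebra. *)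

(* Defs.v *)
From HB Require Import structures.
From mathcomp Require Import all_boot all_order all_algebra.
From mathcomp Require Import all_classical all_reals all_analysis.
From mathcomp Require Import measurable_realfun.

Set Implicit Arguments.
Unset Strict Implicit.
Unset Printing Implicit Defensive.

Import Order.TTheory GRing.Theory Num.Theory.
Import numFieldNormedType.Exports.

Local Open Scope classical_set_scope.
Local Open Scope ring_scope.

(* n-fold product of a sigma-finite measure on n.-tuple T (equipped by the
   library with the product sigma-algebra): mu^0 is the point mass at the empty
   tuple and mu^(n+1) is the image of mu \x mu^n under tcons.
   It is characterized by its values on boxes, see power_measure_box. *)
Section power_measure.
Context d (T : measurableType d) (R : realType).

Definition tcons n (p : (T * n.-tuple T)%type) : n.+1.-tuple T :=
  [tuple of p.1 :: p.2].

Lemma measurable_tcons n : measurable_fun setT (@tcons n).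
Proof. exact: measurable_cons. Qed.

Variable mu : {sigma_finite_measure set T -> \bar R}.

Section step.
Variables (n : nat) (m : {sigma_finite_measure set (n.-tuple T) -> \bar R}).

Definition tcons_measure : set (n.+1.-tuple T) -> \bar R :=
  pushforward (mu \x m)%E (@tcons n).

Let mtcons := @measurable_tcons n.

Let tcons_measure0 : (tcons_measure set0 = 0)%E.
Proof. exact: measure0. Qed.

Let tcons_measure_ge0 A : (0 <= tcons_measure A)%E.
Proof. exact: measure_ge0. Qed.

Let tcons_measure_sigma_additive : semi_sigma_additive tcons_measure.
Proof. exact: measure_semi_sigma_additive. Qed.

HB.instance Definition _ := isMeasure.Build _ _ _ tcons_measure
  tcons_measure0 tcons_measure_ge0 tcons_measure_sigma_additive.

Let tcons_measure_sigma_finite : sigma_finite setT tcons_measure.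
Proof.
have /sigma_finiteP[F [FT ndF mF]] := sigma_finiteT mu.
have /sigma_finiteP[G [GT ndG mG]] := sigma_finiteT m.
pose h (t : n.+1.-tuple T) : (T * n.-tuple T)%type :=
  (thead t, [tuple of behead t]).
have hK p : h (tcons p) = p.
  by case: p => a t; rewrite /h /tcons theadE; congr pair; exact: val_inj.
have mh : measurable_fun setT h.
  apply: measurable_fun_pair; first exact: measurable_tnth.
  exact: measurable_behead.
exists (fun k => h @^-1` (F k `*` G k)) => [|k].
  rewrite -preimage_bigcup; apply/seteqP; split => // t _.
  have : setT (thead t) by [].
  rewrite FT => -[i _ Fi].
  have : setT [tuple of behead t] by [].
  rewrite GT => -[j _ Gj].
  exists (maxn i j) => //; split.
    by move: Fi; exact/subsetPset/ndF/leq_maxl.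
  by move: Gj; exact/subsetPset/ndG/leq_maxr.
have [mFk fFk] := mF k; have [mGk fGk] := mG k; split.
  by rewrite -[X in measurable X]setTI; apply: mh => //; exact: measurableX.
rewrite /tcons_measure /pushforward -comp_preimage.
rewrite (_ : h \o _ = id) ?preimage_id; last exact/funext.
by rewrite product_measure1E// lte_mul_pinfty// ge0_fin_numE.
Qed.

HB.instance Definition _ := Measure_isSigmaFinite.Build _ _ _ tcons_measure
  tcons_measure_sigma_finite.
End step.

Fixpoint power_measure_rec n :
    {sigma_finite_measure set (n.-tuple T) -> \bar R} :=
  match n with
  | 0 => dirac [tuple]
  | n'.+1 => tcons_measure (power_measure_rec n')
  end.

Definition power_measure n : set (n.-tuple T) -> \bar R := power_measure_rec n.
Arguments power_measure : clear implicits.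

HB.instance Definition _ n :=
  SigmaFiniteMeasure.copy (power_measure n) (power_measure_rec n).

Lemma measurable_box n (A : 'I_n -> set T) : (forall i, measurable (A i)) ->
  measurable [set t : n.-tuple T | forall i, A i (tnth t i)].
Proof.
move=> mA.
rewrite (_ : mkset _ =
    \bigcap_(i in [set: 'I_n]) ((@tnth _ T)^~ i @^-1` A i)).
  apply: fin_bigcap_measurable => // i _; rewrite -[X in measurable X]setTI.
  exact: measurable_tnth.
by apply/seteqP; split => [t tA i _|t tA i]; [exact: tA|exact: (tA i Logic.I)].
Qed.

Lemma power_measure_box n (A : 'I_n -> set T) : (forall i, measurable (A i)) ->
  (power_measure n [set t | forall i, A i (tnth t i)] =
   \prod_(i < n) mu (A i))%E.
Proof.
elim: n A => [|n ih] A mA.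
  rewrite big_ord0 (_ : mkset _ = setT); first exact: diracT.
  by apply/seteqP; split => // t _ [].
rewrite big_ord_recl -ih// -product_measure1E//; last first.
  by apply: (measurable_box (A := fun i => A (lift ord0 i))).
rewrite /power_measure /= /tcons_measure /pushforward; congr product_measure1.
apply/seteqP; split => -[a t]; rewrite /tcons /=.
  move=> tA; split=> [|i]; [have := tA ord0|have := tA (lift ord0 i)];
    by rewrite ?tnth0 ?tnthS.
by move=> [Aa tA] i; case: (unliftP ord0 i) => [j ->|->]; rewrite ?tnth0 ?tnthS.
Qed.
End power_measure.
Arguments power_measure {d T R} mu n.

Section iid_law.
Context d (T : measurableType d) (R : realType) (P : probability T R).

Definition iid_law n : set (n.-tuple T) -> \bar R := power_measure P n.
Arguments iid_law : clear implicits.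

HB.instance Definition _ n := Measure.on (iid_law n).

Let iid_law_setT n : iid_law n setT = 1%E.
Proof.
rewrite (_ : setT = [set t : n.-tuple T | forall i : 'I_n, setT (tnth t i)]).
  rewrite /iid_law (power_measure_box P (A := fun=> setT))//.
  by apply: big1 => i _; exact: probability_setT.
by apply/seteqP; split.
Qed.

HB.instance Definition _ n :=
  Measure_isProbability.Build _ _ _ (iid_law n) (iid_law_setT n).
End iid_law.
Arguments iid_law {d T R} P n.

(* iid_law P n is the joint law of n independent random variables of law P. *)
Lemma iid_lawE d (T : measurableType d) (R : realType) (P : probability T R)
    d' (Omega : measurableType d') (Q : probability Omega R) n
    (X : 'I_n -> {RV Q >-> T}) :
  (forall A : 'I_n -> set T, (forall i, measurable (A i)) ->
    (Q [set w | forall i, A i (X i w)] = \prod_(i < n) Q (X i @^-1` A i))%E) ->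
  (forall i A, measurable A -> distribution Q (X i) A = P A) ->
  forall B, measurable B ->
    Q ((fun w => [tuple X i w | i < n]) @^-1` B) = iid_law P n B.
Proof.
move=> indX lawX B mB.
pose h w := [tuple X i w | i < n].
have mh : measurable_fun setT h.
  apply/measurable_fun_tnthP => i.
  rewrite (_ : _ \o _ = X i); first exact: measurable_funPT.
  by apply/funext => w /=; rewrite tnth_mktuple.
pose mh_mixin := isMeasurableFun.Build _ _ _ _ _ mh.
pose H : {mfun Omega >-> n.-tuple T} := HB.pack h mh_mixin.
rewrite -[LHS]/(distribution Q H B).
pose G : set (set (n.-tuple T)) := [set C | exists2 A : 'I_n -> set T,
  forall i, measurable (A i) & C = [set t | forall i, A i (tnth t i)]].
have GT : G setT.
  by exists (fun=> setT) => //; apply/seteqP; split.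
apply: (measure_unique G (fun=> setT)) => //.
- rewrite eqEsubset; split => C.
    apply: smallest_sub; first exact: smallest_sigma_algebra.
    move=> D; rewrite -bigcup_seq => -[j _] [A mA <-].
    apply: sub_sigma_algebra; exists (fun i => if i == j then A else setT).
      by move=> i; case: ifP.
    rewrite setTI; apply/seteqP; split => t /= tA.
      by move=> i; case: eqP => // ->.
    by have := tA j; rewrite eqxx.
  apply: smallest_sub; first exact: sigma_algebra_measurable.
  by move=> _ [A mA ->]; exact: measurable_box.
- move=> _ _ [A mA ->] [A' mA' ->]; exists (fun i => A i `&` A' i).
    by move=> i; exact: measurableI.
  apply/seteqP; split => t /=; first by move=> [tA tA'] i; split.
  by move=> tA; split => i; have [] := tA i.
- by rewrite bigcup_const.
- move=> _ [A mA ->]; rewrite [RHS]power_measure_box//.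
  transitivity (Q [set w | forall i, A i (X i w)]).
    congr (Q _); apply/seteqP; split => w /= wA i; have := wA i;
      by rewrite tnth_mktuple.
  by rewrite indX//; apply: eq_bigr => i _; exact: lawX.
- move=> _; suff : (distribution Q H setT < +oo)%E by [].
  by rewrite probability_setT ltry.
Qed.

(* R^n; by borelR_measurableE its product sigma-algebra is the Borel one. *)
Notation borelR R n := (n.-tuple (measurableTypeR R)).

Lemma borelR_measurableE (R : realType) n (A : set (borelR R n)) :
  measurable A <->
  <<s (@open 'rV[R]_n) >> [set v | A [tuple v ord0 i | i < n]].
Proof.
pose h (v : g_sigma_algebraType (@open 'rV[R]_n)) : borelR R n :=
  [tuple (v : 'rV[R]_n) ord0 i | i < n].
pose h' (t : borelR R n) : g_sigma_algebraType (@open 'rV[R]_n) :=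
    (\row_i tnth t i : 'rV[R]_n).
have h'K : cancel h' h.
  by move=> t; apply: eq_from_tnth => i; rewrite tnth_mktuple mxE.
have mh : measurable_fun setT h.
  apply/measurable_fun_tnthP => i.
  apply: (measurability _ (RGenOpens.measurableE R)) => _ [_ [a [b ->] <-]].
  rewrite setTI; apply: sub_sigma_algebra.
  rewrite (_ : _ @^-1` _ =
      (fun v : 'rV[R]_n => v ord0 i) @^-1` `]a, b[%classic).
    have /continuousP := @coord_continuous R 1 n ord0 i; apply.
    exact: interval_open.
  by apply/seteqP; split => v /=; rewrite tnth_mktuple.
have mh' : measurable_fun setT h'.
  apply: (@measurability _ _ (borelR R n)
    (g_sigma_algebraType (@open 'rV[R]_n)) setT h' (@open 'rV[R]_n) erefl) => _ [U oU <-].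
  rewrite setTI.
  pose box (p : n.-tuple (rat * rat)) : set (borelR R n) :=
    [set t | forall i,
      `](ratr (tnth p i).1), (ratr (tnth p i).2)[%classic (tnth t i)].
  have mbox p : measurable (box p).
    apply: (@measurable_box _ (measurableTypeR R) n
      (fun i => `](ratr (tnth p i).1), (ratr (tnth p i).2)[%classic)) => i.
    exact: measurable_itv.
  pose F k := if unpickle k is Some p then
    [set t | box p `<=` h' @^-1` U /\ box p t] else set0.
  rewrite (_ : _ @^-1` _ = \bigcup_k F k).
    apply: bigcupT_measurable => k; rewrite /F; case: unpickle => // p.
    have [pU|pU] := pselect (box p `<=` h' @^-1` U).
      by rewrite (_ : mkset _ = box p)//; apply/seteqP; split => [t []|t].
    by rewrite (_ : mkset _ = set0)//; apply/seteqP; split => [t []|t].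
  apply/seteqP; split => [t Ut|t [k _]]; last first.
    by rewrite /F; case: unpickle => // p [pU] /pU.
  move: oU; rewrite openE => /(_ _ Ut) /nbhs_ballP[e /= e0 eU].
  have /choice[q qP] : forall i, exists q : rat * rat,
      [/\ tnth t i - e < ratr q.1, ratr q.1 < tnth t i,
          tnth t i < ratr q.2 & ratr q.2 < tnth t i + e] :> Prop.
    move=> i.
    have /rat_in_itvoo[q1] : tnth t i - e < tnth t i by rewrite ltrBlDr ltrDl.
    have /rat_in_itvoo[q2] : tnth t i < tnth t i + e by rewrite ltrDl.
    rewrite !in_itv /= => /andP[? ?] /andP[? ?].
    by exists (q1, q2).
  exists (pickle [tuple q i | i < n]) => //; rewrite /F pickleK; split.
    move=> u ut; apply: eU; split => // j i; rewrite !mxE.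
    have := ut i; rewrite /= in_itv /= tnth_mktuple => /andP[u1 u2].
    have [q1 q2 q3 q4] := qP i.
    rewrite /ball /= ltr_distlC; apply/andP; split.
      exact: lt_trans q1 u1.
    exact: lt_trans u2 q4.
  move=> i; rewrite /= in_itv /= tnth_mktuple.
  by have [q1 q2 q3 q4] := qP i; rewrite q2.
split => [mA|mA].
  by have := mh measurableT _ mA; rewrite setTI.
rewrite (_ : A = h' @^-1` (h @^-1` A)).
  by rewrite -[X in measurable X]setTI; exact: mh'.
by apply/seteqP; split => t /=; rewrite h'K.
Qed.

Section sufficiency.
Context d (X : measurableType d) (R : realType).

(* q is a version of P(E | T), the conditional probability of E given sigma(T);
   versions exist and agree P-almost everywhere. *)
Definition is_cond_prob (P : probability X R) d' (Y : measurableType d')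
    (T : X -> Y) (E : set X) (q : X -> R) : Prop :=
  [/\ measurable_fun [set: g_sigma_algebra_preimageType T] q,
      P.-integrable setT (EFin \o q) &
      forall B, g_sigma_algebra_preimage T B ->
        (\int[P]_(x in B) (q x)%:E = P (E `&` B))%E].

Definition sufficient (Theta : Type) (P : Theta -> probability X R)
    d' (Y : measurableType d') (T : X -> Y) : Prop :=
  measurable_fun setT T /\
  forall E, measurable E ->
    exists kappa : Y -> R, measurable_fun setT kappa /\
      forall theta, exists2 q, is_cond_prob (P theta) T E q &
        {ae P theta, forall x, q x = kappa (T x)}.

Definition minimal_sufficient (Theta : Type) (P : Theta -> probability X R)
    d' (Y : measurableType d') (T : X -> Y) : Prop :=
  sufficient P T /\
  forall d'' (Z : measurableType d'') (S : X -> Z), sufficient P S ->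
    exists f : Z -> Y, measurable_fun setT f /\
      forall theta, {ae P theta, forall x, T x = f (S x)}.

(* f is a Radon-Nikodym derivative dP/dmu. *)
Definition is_density (P mu : {measure set X -> \bar R}) (f : X -> R) : Prop :=
  [/\ measurable_fun setT f, (forall x, 0 <= f x) &
      forall A, measurable A -> (P A = \int[mu]_(x in A) (f x)%:E)%E].

End sufficiency.

Definition lebesgue_n (R : realType) n :
    {measure set (borelR R n) -> \bar R} :=
  power_measure (@lebesgue_measure R) n.

Definition normal_law (R : realType) n (theta : R) :
    probability (borelR R n) R :=
  iid_law (normal_prob theta 1) n.

(* The usual density of normal_law n theta, set to 0 at the point g theta. *)
Definition modified_density (R : realType) n (g : R -> borelR R n) (theta : R)
    (x : borelR R n) : R :=
  ((2 * pi) `^ (n%:R / 2))^-1 *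
  expR (- (1 / 2) * (\sum_(i < n) tnth x i ^+ 2)
        + theta * (\sum_(i < n) tnth x i) - n%:R / 2 * theta ^+ 2) *
  \1_(~` [set g theta]) x.

(* Main.v *)
Require Import Defs.
From HB Require Import structures.
From mathcomp Require Import all_boot all_order all_algebra.
From mathcomp Require Import all_classical all_reals all_analysis.
From mathcomp Require Import measurable_realfun perm ring.

(** Each point of the sample space is a zero of one of the densities: since g
is onto, x = g theta for some theta, and f theta vanishes at x and nowhere
else. A relation f theta y = f theta x * h valid for all theta therefore forces
y = x, so the likelihood-ratio criterion (2) singles out the identity. Yet f
theta is still a density, because it has been altered on a Lebesgue-null set
only (lebesgue_n_set1, is_density_ae); that the product of the one-dimensional
normal densities is a density of the product law follows from Tonelli's theorem
(is_density_prod, is_density_power).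

The identity fails to be minimal sufficient because an iid model is
exchangeable. Let s exchange two coordinates and let S pick one point in each
orbit of s, namely the one whose two coordinates are in increasing order. The
conditional probability of E given S is the average of the indicators of E and
of s^-1 E, whatever theta is, so S is sufficient
(orbit_representative_sufficient). If the identity were almost surely a
function of S, then, as S does not separate x from s x and s preserves the law,
almost every point would be fixed by s (minimal_sufficient_id_fixed). But the
points whose two coordinates lie in two disjoint intervals are moved by s, and
they form a set of positive probability (iid_id_not_minimal_sufficient). *)

Set Implicit Arguments.
Unset Strict Implicit.
Unset Printing Implicit Defensive.

Import Order.TTheory GRing.Theory Num.Theory.
Import numFieldNormedType.Exports.

Local Open Scope classical_set_scope.
Local Open Scope ring_scope.

(** * Densities of product measures *)

Section weighted_measure.
Context {d} {X : measurableType d} {R : realType}.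
Variables (mu : {measure set X -> \bar R}) (f : X -> R).
Hypotheses (mf : measurable_fun setT f) (f0 : forall x, 0 <= f x).

(** The two proofs are arguments so that the measure structure below can be
inferred from the term. *)
Definition weighted_measure of measurable_fun setT f & (forall x, 0 <= f x) :=
  fun A : set X => (\int[mu]_(x in A) (f x)%:E)%E.

Let nu := weighted_measure mf f0.

Let nu0 : nu set0 = 0%E. Proof. exact: integral_set0. Qed.

Let nu_ge0 A : (0 <= nu A)%E.
Proof. by apply: integral_ge0 => x _; rewrite lee_fin. Qed.

Let nu_sigma_additive : semi_sigma_additive nu.
Proof.
move=> F mF tF mUF; rewrite /nu /weighted_measure ge0_integral_bigcup//.
- apply: is_cvg_ereal_nneg_natsum_cond => k _ _.
  by apply: integral_ge0 => x _; rewrite lee_fin.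
- exact/measurable_EFinP/measurable_funTS.
- by move=> x _; rewrite lee_fin.
Qed.

HB.instance Definition _ :=
  isMeasure.Build _ _ _ (weighted_measure mf f0) nu0 nu_ge0 nu_sigma_additive.

End weighted_measure.

(** Measures on a product are determined by their values on rectangles, and on
a rectangle Tonelli's theorem splits the integral of the product of the
densities. *)
Lemma is_density_prod d1 d2 (X : measurableType d1) (Y : measurableType d2)
    (R : realType) (P mu : {sigma_finite_measure set X -> \bar R})
    (Q nu : {sigma_finite_measure set Y -> \bar R}) (f : X -> R) (h : Y -> R) :
  is_density P mu f -> is_density Q nu h ->
  is_density (P \x Q)%E (mu \x nu)%E (fun z => f z.1 * h z.2).
Proof.
move=> [mf f0 Pf] [mh h0 Qh].
have mfh : measurable_fun setT (fun z : X * Y => f z.1 * h z.2).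
  by apply: measurable_funM; exact: measurableT_comp.
have fh0 (z : X * Y) : 0 <= f z.1 * h z.2 by exact: mulr_ge0.
split=> // C mC.
have := @product_measure_unique _ _ _ _ _ P Q
  (weighted_measure (mu \x nu)%E mfh fh0).
apply => // A B mA mB.
transitivity (\int[(mu \x nu)%E]_z
   ((f z.1 * \1_A z.1)%:E * (h z.2 * \1_B z.2)%:E)%E)%E.
  rewrite /= /weighted_measure integral_mkcond.
  apply: eq_integral => -[x y] _ /=.
  rewrite patchE -EFinM in_setX /= !indicE.
  case: (x \in A) => /=; case: (y \in B) => /=;
    by rewrite ?mulr1 ?mulr0 ?mul0r.
have mfA : measurable_fun setT (fun x => f x * \1_A x).
  by apply: measurable_funM => //; exact: measurable_indic.
have mhB : measurable_fun setT (fun x => h x * \1_B x).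
  by apply: measurable_funM => //; exact: measurable_indic.
have fA0 x : 0 <= f x * \1_A x by apply: mulr_ge0; rewrite ?indicE.
have hB0 x : 0 <= h x * \1_B x by apply: mulr_ge0; rewrite ?indicE.
have intE d' (Z : measurableType d') (m : {measure set Z -> \bar R})
    (u : Z -> R) (D : set Z) :
    (\int[m]_z (u z * \1_D z)%:E = \int[m]_(z in D) (u z)%:E)%E.
  rewrite [RHS]integral_mkcond; apply: eq_integral => z _.
  by rewrite patchE indicE; case: (z \in D); rewrite ?mulr1 ?mulr0.
rewrite fubini_tonelli1//=; last 2 first.
- by apply: emeasurable_funM; apply/measurable_EFinP;
    [exact: measurableT_comp mfA _|exact: measurableT_comp mhB _].
- by move=> z; apply: mule_ge0; rewrite lee_fin.
rewrite /fubini_F /=.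
under eq_integral => x _.
  rewrite ge0_integralZl_EFin//; last exact/measurable_EFinP.
    rewrite intE -Qh// muleC; over.
  by move=> y _; rewrite lee_fin.
rewrite ge0_integralZl//; first by rewrite intE -Pf// muleC.
- exact/measurable_EFinP.
- by move=> x _; rewrite lee_fin.
Qed.

(** The (n+1)-st power is the image under tcons of a product with the n-th one,
so the product case transfers by change of variables. *)
Lemma is_density_power d (X : measurableType d) (R : realType)
    (P mu : {sigma_finite_measure set X -> \bar R}) (f : X -> R) n :
  is_density P mu f ->
  is_density (power_measure P n) (power_measure mu n)
    (fun t => \prod_(i < n) f (tnth t i)).
Proof.
move=> df; have [mf f0 _] := df; elim: n => [|n IH].
  split => [||A mA].
  - by under eq_fun do rewrite big_ord0; exact: measurable_cst.
  - by move=> t; exact: prodr_ge0.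
  - under eq_integral do rewrite big_ord0.
    by rewrite integral_cst// mul1e.
have [_ _ dprod] := is_density_prod df IH.
have mprod : measurable_fun setT
    (fun t : n.+1.-tuple X => \prod_(i < n.+1) f (tnth t i)).
  apply: measurable_prod => i _; apply: measurableT_comp => //.
  exact: measurable_tnth.
split => [//|t|A mA]; first exact: prodr_ge0.
rewrite [RHS]ge0_integral_pushforward//; first last.
- by move=> t _; rewrite lee_fin prodr_ge0.
- exact/measurable_EFinP/measurable_funTS.
- exact: measurable_tcons.
rewrite [LHS]dprod; last first.
  by rewrite -[X in measurable X]setTI; exact: measurable_tcons.
apply: eq_integral => -[x t] _ /=; rewrite big_ord_recl tnth0.
by under [in RHS]eq_bigr do rewrite tnthS.
Qed.

Lemma is_density_ae d (X : measurableType d) (R : realType)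
    (P mu : {measure set X -> \bar R}) (f h : X -> R) :
  is_density P mu f -> measurable_fun setT h -> (forall x, 0 <= h x) ->
  {ae mu, forall x, f x = h x} -> is_density P mu h.
Proof.
move=> [mf f0 Pf] mh h0 fh; split => // A mA; rewrite Pf//.
apply: ge0_ae_eq_integral => //.
- exact/measurable_EFinP/measurable_funTS.
- exact/measurable_EFinP/measurable_funTS.
- by move=> x _; rewrite lee_fin.
- by move=> x _; rewrite lee_fin.
- by apply: filterS fh => x /= -> _.
Qed.

(** * The modified normal densities *)

Lemma lebesgue_n_set1 (R : realType) n (a : borelR R n) : (0 < n)%N ->
  measurable [set a] /\ lebesgue_n R n [set a] = 0%E.
Proof.
move=> n0.
have -> : [set a] = [set t : borelR R n | forall i,
    [set tnth a i]%classic (tnth t i)].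
  apply/seteqP; split => [t -> //|t ta]; exact: eq_from_tnth.
split; first by apply: (measurable_box (T := measurableTypeR R)
  (A := fun i => [set tnth a i])) => i; exact: measurable_set1.
transitivity (\prod_(i < n) (@lebesgue_measure R) [set tnth a i])%E.
  by apply: (power_measure_box (@lebesgue_measure R)
    (A := fun i => [set tnth a i])) => i; exact: measurable_set1.
by rewrite (bigD1 (Ordinal n0))//= lebesgue_measure_set1 mul0e.
Qed.

Lemma normal_density (R : realType) (theta : R) :
  is_density (normal_prob theta 1) lebesgue_measure (normal_pdf theta 1).
Proof.
split => [|x|//]; [exact: measurable_normal_pdf|exact: normal_pdf_ge0].
Qed.

(** The normal density vanishes nowhere, so its integral over a set vanishes
only when the set is null. *)
Lemma normal_prob_neq0 (R : realType) (theta : R) (A : set R) : measurable A ->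
  (lebesgue_measure A != 0 -> normal_prob theta 1 A != 0)%E.
Proof.
move=> mA; apply: contra_neq => PA0.
have mpdf : measurable_fun A (fun x => (normal_pdf theta 1 x)%:E).
  apply/measurable_EFinP; apply: measurable_funTS.
  exact: measurable_normal_pdf.
have : ae_eq lebesgue_measure A (fun x => (normal_pdf theta 1 x)%:E) (cst 0%E).
  apply: (ae_eq_integral_abs lebesgue_measure mA mpdf).1; rewrite -[RHS]PA0.
  by apply: eq_integral => x _; rewrite gee0_abs// lee_fin normal_pdf_ge0.
move=> [N [mN N0 AN]]; have AN' : A `<=` N.
  move=> x Ax; apply: AN => /= /(_ Ax)[]; rewrite normal_pdfE ?oner_neq0//.
  by apply/eqP; rewrite mulf_neq0 ?gt_eqF ?normal_peak_gt0 ?expR_gt0 ?oner_neq0.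
exact: (@subset_measure0 _ _ _ (@lebesgue_measure R) _ _ mA mN AN' N0).
Qed.

Lemma modified_densityE (R : realType) n (g : R -> borelR R n) theta x :
  modified_density g theta x =
  (\prod_(i < n) normal_pdf theta 1 (tnth x i)) * \1_(~` [set g theta]) x.
Proof.
rewrite /modified_density normal_pdfE ?oner_neq0//.
rewrite big_split /= prodr_const cardT size_enum_ord; congr (_ * _ * _).
  rewrite /normal_peak expr1n mul1r -[pi *+ 2]mulr_natl exprVn; congr (_^-1).
  by rewrite (mulrC n%:R) powRrM powR_mulrn ?powR_ge0// powR12_sqrt
    ?mulr_ge0 ?pi_ge0.
rewrite /normal_fun -expR_sum; congr expR.
transitivity (\sum_(i < n) (- (1 / 2) * tnth x i ^+ 2 + theta * tnth x i -
    theta ^+ 2 / 2)).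
  rewrite !big_split /= -!mulr_sumr sumr_const cardT size_enum_ord.
  by rewrite -[in RHS]mulr_natl; field.
by apply: eq_bigr => i _; rewrite expr1n; field.
Qed.

(** For n = 0 the sample space is a single point of positive measure, and the
modification is not negligible. *)
Lemma modified_density_is_density (R : realType) n (g : R -> borelR R n) theta :
  (0 < n)%N ->
  is_density (normal_law n theta) (lebesgue_n R n) (modified_density g theta).
Proof.
move=> n0; have [mg g0] := lebesgue_n_set1 (g theta) n0.
have dn := is_density_power n (normal_density theta).
apply: (is_density_ae dn); have [mf f0 _] := dn.
- rewrite (funext (modified_densityE g theta)).
  apply: measurable_funM => //; exact/measurable_indic/measurableC.
- by move=> x; rewrite modified_densityE mulr_ge0.
- exists [set g theta]; split => // x /= fx; apply: contrapT => xg; apply: fx.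
  by rewrite modified_densityE indicE mem_set// mulr1.
Qed.

Lemma modified_density_eq0 (R : realType) n (g : R -> borelR R n) theta x :
  modified_density g theta x = 0 <-> x = g theta.
Proof.
rewrite modified_densityE indicE in_setC; split => [|->]; last first.
  by rewrite mem_set// mulr0.
have [/set_mem //|_] := boolP (x \in [set g theta]).
rewrite mulr1 => /eqP; rewrite gt_eqF//; apply: prodr_gt0 => i _.
by rewrite normal_pdfE ?oner_neq0//
  mulr_gt0 ?normal_peak_gt0 ?expR_gt0 ?oner_neq0.
Qed.

(** * Sufficient statistics from a measure-preserving involution *)

Section symmetry.
Context {d} {X : measurableType d} {R : realType}.
Context {Theta : Type} {P : Theta -> probability X R}.
Variables s S : X -> X.
Hypotheses (ms : measurable_fun setT s) (mS : measurable_fun setT S).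
Hypothesis Ps : forall theta A, measurable A -> P theta (s @^-1` A) = P theta A.
Hypothesis sK : involutive s.
Hypothesis Ss : forall x, S (s x) = S x.
Hypothesis SE : forall x, S x = x \/ S x = s x.

(** The average kappa of the indicators of E and s^-1 E is unchanged by s, hence
equals kappa o S. Its integral over an S-measurable set B is P E on B because B
is s-invariant, and so E and s^-1 E meet B in sets of the same probability. *)
Lemma orbit_representative_sufficient : sufficient P S.
Proof.
split=> // E mE; pose kappa x : R := 2^-1 * (\1_E x + \1_E (s x)).
have mk : measurable_fun setT kappa.
  apply: measurable_funM => //; apply: measurable_funD.
    exact: measurable_indic.
  by apply: measurableT_comp => //; exact: measurable_indic.
have kS x : kappa (S x) = kappa x.
  by case: (SE x) => -> //; rewrite /kappa sK addrC.
exists kappa; split => // theta; exists (kappa \o S); last exact: aeW.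
have msE : measurable (s @^-1` E).
  by rewrite -[X in measurable X]setTI; exact: ms.
have qE x : ((kappa \o S) x)%:E =
    ((2^-1)%:E * ((\1_E x)%:E + (\1_(s @^-1` E) x)%:E))%E.
  by rewrite /= kS /kappa EFinM EFinD.
split.
- by move=> _ B mB; exists (kappa @^-1` B) => //;
    rewrite -[X in measurable X]setTI; exact: mk.
- rewrite (_ : EFin \o _ = (fun x => ((2^-1)%:E *
    ((\1_E x)%:E + (\1_(s @^-1` E) x)%:E))%E)); last exact/funext.
  by apply: integrableZl => //; apply: integrableD => //;
    exact: integrable_indic.
move=> B [C mC]; rewrite setTI => <-.
have mSC : measurable (S @^-1` C).
  by rewrite -[X in measurable X]setTI; exact: mS.
have mI D : measurable D ->
    measurable_fun (S @^-1` C) (fun x => (\1_D x : R)%:E).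
  by move=> mD; apply/measurable_EFinP/measurable_funTS/measurable_indic.
under eq_integral => x _ do rewrite qE.
rewrite ge0_integralZl_EFin//=; last 2 first.
- by move=> x _; rewrite adde_ge0 ?lee_fin.
- by apply: emeasurable_funD; exact: mI.
rewrite ge0_integralD//; [|exact: mI..].
rewrite !integral_indic//.
have PsE : P theta (s @^-1` E `&` S @^-1` C) = P theta (E `&` S @^-1` C).
  rewrite -[RHS]Ps; last exact: measurableI.
  by congr (P theta _); apply/seteqP; split => x; rewrite /= Ss.
transitivity ((2^-1)%:E * (P theta (E `&` S @^-1` C) +
    P theta (E `&` S @^-1` C)))%E; first by congr (_ * (_ + _))%E.
rewrite -(@fineK _ (P theta _)) ?fin_num_measure//; last exact: measurableI.
by rewrite -EFinD -EFinM -mulr2n -[fine _ *+ 2]mulr_natl mulKf ?pnatr_eq0.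
Qed.

(** S being sufficient, x = f (S x) almost surely for some f and, s being measure
preserving, also s x = f (S (s x)); the two right-hand sides agree. *)
Lemma minimal_sufficient_id_fixed : minimal_sufficient P (fun x : X => x) ->
  forall theta, {ae P theta, forall x, s x = x}.
Proof.
move=> [_ /(_ _ _ S orbit_representative_sufficient)[f [_ fS]]] theta.
have [N [mN N0 fN]] := fS theta.
exists (N `|` s @^-1` N); split.
- apply: measurableU => //; rewrite -[X in measurable X]setTI; exact: ms.
- apply: null_set_setU => //; last by rewrite /= Ps.
  by rewrite -[X in measurable X]setTI; exact: ms.
- apply: subsetCl => x /not_orP[Nx Nsx] /=.
  have notin y : ~ N y -> y = f (S y) by move=> Ny; apply: contrapT => /fN.
  by rewrite (notin _ Nsx) Ss -notin.
Qed.
End symmetry.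

(** * Exchangeability of iid samples *)

Definition swap_tuple {T : Type} {n} (i j : 'I_n) (t : n.-tuple T) :
    n.-tuple T :=
  [tuple tnth t (tperm i j k) | k < n].

Lemma measurable_swap_tuple d (T : measurableType d) n (i j : 'I_n) :
  measurable_fun setT (@swap_tuple T n i j).
Proof.
apply/measurable_fun_tnthP => k.
rewrite (_ : _ \o _ = (@tnth _ T)^~ (tperm i j k)).
  exact: measurable_tnth.
by apply/funext => t /=; rewrite tnth_mktuple.
Qed.

Lemma swap_tupleK (T : Type) n (i j : 'I_n) : involutive (@swap_tuple T n i j).
Proof.
by move=> t; apply: eq_from_tnth => k; rewrite !tnth_mktuple tpermK.
Qed.

Lemma iid_law_tnth d (T : measurableType d) (R : realType) (P : probability T R)
    n (k : 'I_n) (B : set T) : measurable B ->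
  iid_law P n ((@tnth n T)^~ k @^-1` B) = P B.
Proof.
move=> mB; pose A l := if l == k then B else setT.
have mA l : measurable (A l) by rewrite /A; case: ifP.
rewrite (_ : _ @^-1` _ = [set t | forall l, A l (tnth t l)]).
  rewrite [LHS]power_measure_box// (bigD1 k)//= /A eqxx big1 ?mule1//.
  by move=> l /negbTE ->; exact: probability_setT.
apply/seteqP; split => t /= tA.
  by move=> l; rewrite /A; case: eqP => // ->.
by have := tA k; rewrite /A eqxx.
Qed.

(** The coordinates taken in permuted order are again independent with
marginals P, so their joint law is the same. *)
Lemma iid_law_swap d (T : measurableType d) (R : realType) (P : probability T R)
    n (i j : 'I_n) (A : set (n.-tuple T)) : measurable A ->
  iid_law P n (swap_tuple i j @^-1` A) = iid_law P n A.
Proof.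
move=> mA; pose Xk k : n.-tuple T -> T := (@tnth _ T)^~ (tperm i j k).
have mX k : measurable_fun setT (Xk k) by exact: measurable_tnth.
pose X k : {RV (iid_law P n) >-> T} :=
  HB.pack (Xk k) (isMeasurableFun.Build _ _ _ _ _ (mX k)).
have margin k (B : set T) : measurable B -> iid_law P n (X k @^-1` B) = P B.
  by move=> mB; exact: iid_law_tnth.
rewrite -[RHS](iid_lawE (P := P) (Q := iid_law P n) (X := X))// => B mB.
transitivity (\prod_(k < n) P (B k))%E; last first.
  by apply: eq_bigr => k _; rewrite [RHS]margin.
rewrite (_ : mkset _ = [set t | forall k, B (tperm i j k) (tnth t k)]).
  rewrite [LHS](power_measure_box P (A := fun k => B (tperm i j k)))//.
  by rewrite [RHS](reindex_inj (@perm_inj _ (tperm i j))).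
apply/seteqP; split => t /= tB k; have := tB (tperm i j k).
  by rewrite /= /Xk tpermK.
by rewrite tpermK.
Qed.

Lemma iid_law_box2 d (T : measurableType d) (R : realType) (P : probability T R)
    n (i j : 'I_n) (A B : set T) : i != j -> measurable A -> measurable B ->
  iid_law P n [set t | A (tnth t i) /\ B (tnth t j)] = (P A * P B)%E.
Proof.
move=> ij mA mB; pose C k := if k == i then A else if k == j then B else setT.
have mC k : measurable (C k) by rewrite /C; case: ifP => // _; case: ifP.
rewrite (_ : mkset _ = [set t | forall k, C k (tnth t k)]).
  rewrite [LHS]power_measure_box// (bigD1 i)//= (bigD1 j) 1?eq_sym//=.
  rewrite /C !eqxx eq_sym (negbTE ij) big1 ?mule1//.
  move=> k /andP[/negbTE -> /negbTE ->].
  exact: probability_setT.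
apply/seteqP; split => t /=.
  by move=> [tA tB] k; rewrite /C; case: eqP => [->//|_]; case: eqP => [->|].
move=> tC; split; first by have := tC i; rewrite /C eqxx.
by have := tC j; rewrite /C eq_sym (negbTE ij) eqxx.
Qed.

(** The injective coordinate u orders T, which gives a measurable choice between
a sample and the one with coordinates i and j exchanged. Disjointness of A and
B makes samples with coordinates in A and B move under the exchange. *)
Lemma iid_id_not_minimal_sufficient d (T : measurableType d) (R : realType)
    (Theta : Type) (P : Theta -> probability T R) n (i j : 'I_n) (u : T -> R)
    (theta : Theta) (A B : set T) :
  i != j -> measurable_fun setT u -> injective u ->
  measurable A -> measurable B -> A `&` B = set0 ->
  P theta A != 0%E -> P theta B != 0%E ->
  ~ minimal_sufficient (fun theta => iid_law (P theta) n) (fun x => x).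
Proof.
move=> ij mu_u inju mA mB AB PA PB.
pose c t := u (tnth t i) <= u (tnth t j).
pose S t := if c t then t else swap_tuple i j t.
have mS : measurable_fun setT S.
  apply: measurable_fun_ifT => //.
  - apply: measurable_fun_ler; apply: measurableT_comp => //;
    exact: measurable_tnth.
  - exact: measurable_swap_tuple.
have swapi t : tnth (swap_tuple i j t) i = tnth t j.
  by rewrite tnth_mktuple tpermL.
have swapj t : tnth (swap_tuple i j t) j = tnth t i.
  by rewrite tnth_mktuple tpermR.
have Ss t : S (swap_tuple i j t) = S t.
  rewrite /S /c swapi swapj swap_tupleK.
  have [ltij|ltji|eqij] := ltgtP (u (tnth t i)) (u (tnth t j)) => //.
  (* in case of a tie the exchanged sample is the sample itself *)
  apply: eq_from_tnth => k; rewrite tnth_mktuple.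
  by case: tpermP => [->|->|//]; apply: inju.
have SE t : S t = t \/ S t = swap_tuple i j t.
  by rewrite /S; case: (c t); [left|right].
move=> /(minimal_sufficient_id_fixed (@measurable_swap_tuple _ T n i j) mS
  (fun theta => @iid_law_swap _ _ _ (P theta) n i j)
  (@swap_tupleK T n i j) Ss SE)
  /(_ theta)[N [mN N0 fixN]].
have : iid_law (P theta) n [set t | A (tnth t i) /\ B (tnth t j)] = 0%E.
  apply: (subset_measure0 _ _ _ N0) => //.
    rewrite (_ : mkset _ =
      (@tnth n T)^~ i @^-1` A `&` (@tnth n T)^~ j @^-1` B)//.
    by apply: measurableI; rewrite -[X in measurable X]setTI;
      exact: measurable_tnth.
  move=> t [tA tB]; apply: fixN => /= tE.
  have : (A `&` B) (tnth t i) by split => //; rewrite -tE swapi.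
  by rewrite AB.
by rewrite iid_law_box2//; move/eqP; rewrite mule_eq0 (negbTE PA) (negbTE PB).
Qed.

(** * The counterexample *)

Theorem mainTheorem1 (R : realType) (n : nat) (hn : (2 <= n)%N)
    (g : R -> borelR R n)
    (hg : forall y : borelR R n, exists theta : R, g theta = y) :
  let f := @modified_density R n g in
  let T : borelR R n -> borelR R n := fun x => x in
  [/\ forall theta : R,
        is_density (normal_law n theta) (lebesgue_n R n) (f theta),
      forall x y : borelR R n,
        T x = T y <->
        exists2 h : R, 0 < h & forall theta : R, f theta y = f theta x * h &
      ~ minimal_sufficient (fun theta : R => normal_law n theta) T].
Proof.
move=> f T; split => [theta|x y|].
- exact/modified_density_is_density/ltnW.
- split=> [xy|[h h0 fxy]].
    have {}xy : x = y by [].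
    by exists 1 => // theta; rewrite xy mulr1.
  have [theta gx] := hg x.
  have fx0 : f theta x = 0 by apply/modified_density_eq0.
  have /modified_density_eq0 -> : f theta y = 0 by rewrite fxy fx0 mul0r.
  by rewrite gx.
- pose A : set (measurableTypeR R) := `[0, 1]%classic.
  pose B : set (measurableTypeR R) := `[2, 3]%classic.
  apply: (@iid_id_not_minimal_sufficient _ (measurableTypeR R) R R
    (fun theta => normal_prob theta 1) n (Ordinal (ltnW hn)) (Ordinal hn) id
    0 A B) => //.
  + exact: measurable_itv.
  + exact: measurable_itv.
  + rewrite -subset0 /A /B => x /= []; rewrite !in_itv /=.
    move=> /andP[_ x1] /andP[x2 _].
    by have := le_trans x2 x1; rewrite lern1.
  + apply: normal_prob_neq0; first exact: measurable_itv.
    by rewrite lebesgue_measure_itv /= lte_fin ltr01 oppr0 adde0 eqe oner_neq0.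
  + apply: normal_prob_neq0; first exact: measurable_itv.
    rewrite lebesgue_measure_itv /= lte_fin ltr_nat /= -EFinB eqe.
    by rewrite subr_eq0 eqr_nat.
Qed.
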